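(* Consider the rough symplectic partitioned Runge–Kutta (RSPRK) method described in the context, whose coefficients satisfy $$\bar a_{ij}=\frac{\bar b_ja_{ij}}{b_j},\qquad\beta_{ij}=\frac{b_ja_{ji}}{b_i},\qquad\bar\beta_{ij}=\frac{\bar b_ja_{ji}}{b_i}.$$ It possesses the following conservation laws. For all smooth Hamiltonians, $$\mathrm{d}p_k\wedge\mathrm{d}q_k=\mathrm{d}p_{k+1}\wedge\mathrm{d}q_{k+1}.$$ For Hamiltonians linear in $p$, $H(q,p)=\langle p,f(q)\rangle$, $\mathcal{H}(q,p)=\langle p,\sigma(q)\rangle$, $$p_k\,\mathrm{d}q_k=p_{k+1}\,\mathrm{d}q_{k+1}.$$ For Hamiltonians affine in $p$, $H(q,p)=\langle p,f(q)\rangle+L(q)$, $\mathcal{H}(q,p)=\langle p,\sigma(q)\rangle+\mathfrak{L}(q)$, $$\langle p_k,\delta q_k\rangle=\langle p_{k+1},\delta q_{k+1}\rangle+\Delta t\sum_{i=1}^sb_i\Big\langle\frac{\partial L}{\partial q}(Q_{i,k}),\delta Q_{i,k}\Big\rangle+\sum_{i=1}^s\bar b_i\Big\langle\frac{\partial\mathfrak{L}}{\partial q}(Q_{i,k}),\delta Q_{i,k}\Big\rangle\cdot Z_{t_k,t_{k+1}}.$$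
   Context: Let $\mathbf{Z}$ be a geometric $\alpha$-Hölder rough path in $\mathbb{R}^K$ over $[t_0,t_1]$, $\alpha\in(\frac13,\frac12]$, with increment $Z_{t_k,t_{k+1}}=Z_{t_{k+1}}-Z_{t_k}\in\mathbb{R}^K$ on a step $[t_k,t_{k+1}]$ of length $\Delta t$; ''$\cdot Z_{t_k,t_{k+1}}$'' is contraction over the $\mathbb{R}^K$ index. $H\in C^\infty(\mathbb{R}^N\times\mathbb{R}^N,\mathbb{R})$, $\mathcal{H}=(H_1,\dots,H_K)^T\in C^\infty(\mathbb{R}^N\times\mathbb{R}^N,\mathbb{R}^K)$; $f\in C^\infty(\mathbb{R}^N,\mathbb{R}^N)$, $\sigma\in C^\infty(\mathbb{R}^N,\mathcal{L}(\mathbb{R}^K,\mathbb{R}^N))$, $L\in C^\infty(\mathbb{R}^N,\mathbb{R})$, $\mathfrak{L}\in C^\infty(\mathbb{R}^N,\mathcal{L}(\mathbb{R}^K,\mathbb{R}))$, $[\langle p,\sigma(q)\rangle]_j=\sum_ip_i\sigma_{ij}(q)$. The $s$-stage RSPRK method, with coefficients $a_{ij},\bar a_{ij},\beta_{ij},\bar\beta_{ij},b_i,\bar b_i$ ($b_i,\bar b_i\ne0$), is $$Q_{i,k}=q_k+\Delta t\sum_{j=1}^sa_{ij}\tfrac{\partial H}{\partial p}(Q_{j,k},P_{j,k})+\sum_{j=1}^s\bar a_{ij}\tfrac{\partial\mathcal{H}}{\partial p}(Q_{j,k},P_{j,k})\cdot Z_{t_k,t_{k+1}},\quad i=1,\dots,s,$$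 $$P_{i,k}=p_{k+1}+\Delta t\sum_{j=1}^s\beta_{ij}\tfrac{\partial H}{\partial q}(Q_{j,k},P_{j,k})+\sum_{j=1}^s\bar\beta_{ij}\tfrac{\partial\mathcal{H}}{\partial q}(Q_{j,k},P_{j,k})\cdot Z_{t_k,t_{k+1}},\quad i=1,\dots,s,$$ $$q_{k+1}=q_k+\Delta t\sum_{i=1}^sb_i\tfrac{\partial H}{\partial p}(Q_{i,k},P_{i,k})+\sum_{i=1}^s\bar b_i\tfrac{\partial\mathcal{H}}{\partial p}(Q_{i,k},P_{i,k})\cdot Z_{t_k,t_{k+1}},$$ $$p_k=p_{k+1}+\Delta t\sum_{i=1}^sb_i\tfrac{\partial H}{\partial q}(Q_{i,k},P_{i,k})+\sum_{i=1}^s\bar b_i\tfrac{\partial\mathcal{H}}{\partial q}(Q_{i,k},P_{i,k})\cdot Z_{t_k,t_{k+1}},$$ regarded as defining a smooth map $(q_k,p_k)\mapsto(q_{k+1},p_{k+1})$. The variables $\delta q_k,\delta p_k,\delta Q_{i,k},\delta P_{i,k},\delta q_{k+1},\delta p_{k+1}$ satisfy the linearisation of these equations, i.e. the same four equations with the left-hand variables and $q_k,p_{k+1}$ replaced by their $\delta$-versions, with $\frac{\partial F}{\partial p}(Q_{j,k},P_{j,k})$ replaced by $\frac{\partial^2F}{\partial p\partial p}(Q_{j,k},P_{j,k})\,\delta P_{j,k}+\frac{\partial^2F}{\partial p\partial q}(Q_{j,k},P_{j,k})\,\delta Q_{j,k}$ and $\frac{\partial F}{\partial q}(Q_{j,k},P_{j,k})$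 by $\frac{\partial^2F}{\partial q\partial p}(Q_{j,k},P_{j,k})\,\delta P_{j,k}+\frac{\partial^2F}{\partial q\partial q}(Q_{j,k},P_{j,k})\,\delta Q_{j,k}$, for $F=H,\mathcal{H}$. $\mathrm{d}p\wedge\mathrm{d}q=\sum_i\mathrm{d}p_i\wedge\mathrm{d}q^i$ and $p\,\mathrm{d}q=\sum_ip_i\,\mathrm{d}q^i$. *)

(* Defs.v *)
From HB Require Import structures.
From mathcomp Require Import all_boot all_order all_algebra.
From mathcomp Require Import all_classical all_reals all_analysis.

Set Implicit Arguments.
Unset Strict Implicit.
Unset Printing Implicit Defensive.
Import Order.TTheory GRing.Theory Num.Theory.
Import numFieldNormedType.Exports.
Local Open Scope classical_set_scope.
Local Open Scope ring_scope.

(* Vectors of R^n are row vectors. *)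

Section Smoothness.
Context {R : realType}.

(* On an open subset of a finite-dimensional space this is the usual C^n:
   f is differentiable and all its directional derivatives are C^(n-1). *)
Fixpoint Cn_on (V W : normedModType R) (n : nat) (U : set V) (f : V -> W) : Prop :=
  if n is m.+1 then
    (forall x, U x -> differentiable f x) /\ (forall v, Cn_on m U ('D_v f))
  else forall x, U x -> {for x, continuous f}.

Definition smooth_on (V W : normedModType R) (U : set V) (f : V -> W) : Prop :=
  forall n, Cn_on n U f.

Definition smooth (V W : normedModType R) (f : V -> W) : Prop := smooth_on setT f.

End Smoothness.

Section RoughPaths.
Context {R : realType} {K : nat}.

Definition rough_path (alpha t0 t1 : R)
    (Z : R -> 'rV[R]_K) (ZZ : R -> R -> 'M[R]_K) : Prop :=
  [/\ forall s u t, t0 <= s -> s <= u -> u <= t -> t <= t1 ->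
        ZZ s t = ZZ s u + ZZ u t + (Z u - Z s)^T *m (Z t - Z u),
      exists C : R, forall s t, t0 <= s -> s <= t -> t <= t1 ->
        `|Z t - Z s| <= C * (t - s) `^ alpha
    & exists C : R, forall s t, t0 <= s -> s <= t -> t <= t1 ->
        `|ZZ s t| <= C * (t - s) `^ (2 * alpha)].

(* entry (i, j) is the iterated integral of (z^i_r - z^i_s) dz^j_r over [s, t] *)
Definition canonical_lift (z : R -> 'rV[R]_K) (s t : R) : 'M[R]_K :=
  \matrix_(i, j)
    \int[lebesgue_measure]_(r in `[s, t])
      ((z r ord0 i - z s ord0 i) * derive1 (fun x : R => z x ord0 j) r).

(* A geometric rough path is a limit, in the alpha-Hoelder rough path metric,
   of canonical lifts of smooth paths. *)
Definition geometric_rough_path (alpha t0 t1 : R)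
    (Z : R -> 'rV[R]_K) (ZZ : R -> R -> 'M[R]_K) : Prop :=
  rough_path alpha t0 t1 Z ZZ /\
  forall eps : R, 0 < eps ->
    exists2 z : R -> 'rV[R]_K, smooth z &
      forall s t, t0 <= s -> s <= t -> t <= t1 ->
        `|(Z t - Z s) - (z t - z s)| <= eps * (t - s) `^ alpha /\
        `|ZZ s t - canonical_lift z s t| <= eps * (t - s) `^ (2 * alpha).

End RoughPaths.

(* Phase space: pairs (q, p). *)
Notation phase R N := ('rV[R]_N * 'rV[R]_N)%type.

Section Derivatives.
Context {R : realType} {N : nat}.

Definition dot (u v : 'rV[R]_N) : R := \sum_i u ord0 i * v ord0 i.

Definition std_basis (i : 'I_N) : 'rV[R]_N := delta_mx ord0 i.

Definition grad (L : 'rV[R]_N -> R) (q : 'rV[R]_N) : 'rV[R]_N :=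
  \row_i 'D_(std_basis i) L q.

Local Notation phase := (phase R N).

Definition e_q (i : 'I_N) : phase := (std_basis i, 0).
Definition e_p (i : 'I_N) : phase := (0, std_basis i).

Definition pdq (F : phase -> R) (x : phase) : 'rV[R]_N := \row_i 'D_(e_q i) F x.
Definition pdp (F : phase -> R) (x : phase) : 'rV[R]_N := \row_i 'D_(e_p i) F x.

(* d2 u v F x is the matrix of the derivatives of the components
   'D_(u i) F, in the directions v j. *)
Definition d2 (u v : 'I_N -> phase) (F : phase -> R) (x : phase) : 'M[R]_N :=
  \matrix_(i, j) 'D_(v j) ('D_(u i) F) x.

(* The matrices act on the row vectors dx.1 (the variation of q) and dx.2 (the
   variation of p) through M v = v *m M^T. *)
Definition lin_pdq (F : phase -> R) (x dx : phase) : 'rV[R]_N :=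
  dx.2 *m (d2 e_q e_p F x)^T + dx.1 *m (d2 e_q e_q F x)^T.
Definition lin_pdp (F : phase -> R) (x dx : phase) : 'rV[R]_N :=
  dx.2 *m (d2 e_p e_p F x)^T + dx.1 *m (d2 e_p e_q F x)^T.

Definition component {T : Type} {K : nat} (F : T -> 'rV[R]_K) (l : 'I_K) : T -> R :=
  fun x => F x ord0 l.

(* (D F) . z, with D applied to each of the K components of F *)
Definition contract_incr {K : nat} (D : (phase -> R) -> 'rV[R]_N)
    (F : phase -> 'rV[R]_K) (z : 'rV[R]_K) : 'rV[R]_N :=
  \sum_(l < K) z ord0 l *: D (component F l).

End Derivatives.

Section Forms.
Context {R : realType} {V : normedModType R}.

(* A form is given by its values at a point on tangent vectors. *)
Definition one_form := V -> V -> R.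
Definition two_form := V -> V -> V -> R.

Definition ext_d (g : V -> R) : one_form := fun x u => 'd g x u.

Definition wedge (w e : one_form) : two_form :=
  fun x u v => w x u * e x v - w x v * e x u.

Definition dp_wedge_dq {N : nat} (p q : V -> 'rV[R]_N) : two_form :=
  fun x u v => \sum_i wedge (ext_d (component p i)) (ext_d (component q i)) x u v.

Definition p_dq {N : nat} (p q : V -> 'rV[R]_N) : one_form :=
  fun x u => \sum_i p x ord0 i * ext_d (component q i) x u.

End Forms.

Section Method.
Context {R : realType}.

Record rsprk_coefs (s : nat) := RsprkCoefs {
  ca : 'I_s -> 'I_s -> R;
  ca_bar : 'I_s -> 'I_s -> R;
  cbeta : 'I_s -> 'I_s -> R;
  cbeta_bar : 'I_s -> 'I_s -> R;
  cb : 'I_s -> R;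
  cb_bar : 'I_s -> R }.

Context {N s : nat}.

(* The four groups of equations of the method, as relations between the
   variables and the stage vectors: hq, hp stand for the derivatives of the
   drift Hamiltonian, kq, kp for those of the driving ones contracted with the
   increment. *)
Definition rk_equations (c : rsprk_coefs s) (dt : R)
    (hq hp kq kp : 'I_s -> 'rV[R]_N)
    (q p : 'rV[R]_N) (Q P : 'I_s -> 'rV[R]_N) (q' p' : 'rV[R]_N) : Prop :=
  [/\ forall i, Q i = q + dt *: \sum_j ca c i j *: hp j
                        + \sum_j ca_bar c i j *: kp j,
      forall i, P i = p' + dt *: \sum_j cbeta c i j *: hq j
                         + \sum_j cbeta_bar c i j *: kq j,
      q' = q + dt *: \sum_i cb c i *: hp i + \sum_i cb_bar c i *: kp i
    & p = p' + dt *: \sum_i cb c i *: hq i + \sum_i cb_bar c i *: kq i].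

Definition rsprk_step {K : nat} (c : rsprk_coefs s) (dt : R) (z : 'rV[R]_K)
    (H : phase R N -> R) (HH : phase R N -> 'rV[R]_K)
    (q p : 'rV[R]_N) (Q P : 'I_s -> 'rV[R]_N) (q' p' : 'rV[R]_N) : Prop :=
  rk_equations c dt
    (fun j => pdq H (Q j, P j)) (fun j => pdp H (Q j, P j))
    (fun j => contract_incr (fun F => pdq F (Q j, P j)) HH z)
    (fun j => contract_incr (fun F => pdp F (Q j, P j)) HH z)
    q p Q P q' p'.

(* The linearisation of rsprk_step at a solution with stages Q, P. *)
Definition rsprk_step_lin {K : nat} (c : rsprk_coefs s) (dt : R) (z : 'rV[R]_K)
    (H : phase R N -> R) (HH : phase R N -> 'rV[R]_K)
    (Q P : 'I_s -> 'rV[R]_N)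
    (dq dp : 'rV[R]_N) (dQ dP : 'I_s -> 'rV[R]_N) (dq' dp' : 'rV[R]_N) : Prop :=
  rk_equations c dt
    (fun j => lin_pdq H (Q j, P j) (dQ j, dP j))
    (fun j => lin_pdp H (Q j, P j) (dQ j, dP j))
    (fun j => contract_incr (fun F => lin_pdq F (Q j, P j) (dQ j, dP j)) HH z)
    (fun j => contract_incr (fun F => lin_pdp F (Q j, P j) (dQ j, dP j)) HH z)
    dq dp dQ dP dq' dp'.

(* The method is implicit: q', p' : phase -> R^N is the map it defines on an open
   set U of initial data (q, p), with stages Q, P depending smoothly on (q, p). *)
Definition rsprk_map {K : nat} (c : rsprk_coefs s) (dt : R) (z : 'rV[R]_K)
    (H : phase R N -> R) (HH : phase R N -> 'rV[R]_K) (U : set (phase R N))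
    (Q P : 'I_s -> phase R N -> 'rV[R]_N) (q' p' : phase R N -> 'rV[R]_N) : Prop :=
  [/\ open U,
      smooth_on U q' /\ smooth_on U p',
      forall i, smooth_on U (Q i) /\ smooth_on U (P i)
    & forall x, U x ->
        rsprk_step c dt z H HH x.1 x.2 (Q^~ x) (P^~ x) (q' x) (p' x)].

End Method.
Arguments rsprk_coefs : clear implicits.

(* Main.v *)
Require Import Defs.
From HB Require Import structures.
From mathcomp Require Import all_boot all_order all_algebra.
From mathcomp Require Import all_classical all_reals all_analysis.
From mathcomp Require Import ring.

Set Implicit Arguments.
Unset Strict Implicit.
Unset Printing Implicit Defensive.
Import Order.TTheory GRing.Theory Num.Theory.
Import numFieldNormedType.Exports.
Local Open Scope classical_set_scope.
Local Open Scope ring_scope.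

(** Write w_ij = a_ij / b_j. The conditions on the coefficients say that each
    stage enters the equations only through the vectors
      l_i = dt b_i dH/dq + bbar_i dHH/dq . Z,
      g_i = dt b_i dH/dp + bbar_i dHH/dp . Z,
    with Q_i = q + sum_j w_ij g_j, P_i = p' + sum_j w_ji l_j, q' = q + sum_i g_i
    and p = p' + sum_i l_i. The linearised equations have the same form. Since
    the weights for P are the transpose of those for Q, summation by parts
    gives, for the p-half of one such system and the q-half of another,
      <p, dq> = <p', dq'> + sum_i (<l_i, dQ_i> - <P_i, dg_i>)
    (rk_equations_pairing). The right-hand sum is linear in the Hamiltonians,
    which leaves one pairing per Hamiltonian and stage.

    For dp /\ dq both systems are linearisations, at two tangent vectors. The
    stage pairing is then symmetric in the two vectors because the Hessian is
    symmetric (hamiltonian_pairing_sym), so it disappears from the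
    antisymmetric expression dp /\ dq. The symmetry of second derivatives is
    derived from the mean value theorem (derive_comm).

    For p dq the method itself is paired with its linearisation. If the
    Hamiltonian is affine in p, the stage pairing reduces to the derivative of
    its momentum-free part along dQ_i (affine_hamiltonian_pairing), which
    gives the affine law, and the linear one as the case where this part
    vanishes.

    The two laws about differential forms speak of the map defined by the
    method; differentiating the equations along this map shows that its
    derivatives solve the linearisation (rsprk_map_linearised). *)

(** * Second derivatives *)

Section MixedDerivatives.
Context {R : realType} {V : normedModType R}.
Implicit Types (f : V -> R) (x u v : V).

Lemma is_derive_line f x v (t : R) :
  derivable f (t *: v + x) v ->
  is_derive t 1 (fun r : R => f (r *: v + x)) ('D_v f (t *: v + x)).
Proof.
have E : (fun h : R => h^-1 *: (((fun r : R => f (r *: v + x)) \o shift t) (h *: 1)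
    - f (t *: v + x)))
  = (fun h : R => h^-1 *: ((f \o shift (t *: v + x)) (h *: v) - f (t *: v + x))).
  by apply/funext => h /=; rewrite [h *: 1]mulr1 scalerDl addrA.
by move=> df; split; [rewrite /derivable E | rewrite /derive E].
Qed.

Lemma mean_value_line f x v (h : R) : 0 < h -> (forall y, differentiable f y) ->
  exists2 c : R, 0 < c < h & f (h *: v + x) - f x = h * 'D_v f (c *: v + x).
Proof.
move=> h0 df.
pose g (r : R) := f (r *: v + x).
have dg (r : R) : is_derive r 1 g ('D_v f (r *: v + x)).
  exact/is_derive_line/diff_derivable.
have cg : {within `[0, h], continuous g}.
  apply: continuous_subspaceT => r.
  apply: differentiable_continuous; apply/derivable1_diffP.
  exact: ex_derive.
have [c] := MVT h0 (fun r _ => dg r) cg.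
rewrite in_itv /= => cI E; exists c => //.
by move: E; rewrite /g scale0r add0r subr0 mulrC.
Qed.

Lemma derive_translate f w v y : 'D_v (fun z => f (w + z)) y = 'D_v f (w + y).
Proof.
rewrite /derive (_ : (fun h : R => _)
  = (fun h : R => h^-1 *: ((f \o shift (w + y)) (h *: v) - f (w + y)))) //.
by apply/funext => h /=; rewrite addrCA.
Qed.

(** The symmetric second difference of f over a parallelogram: the mean value
    theorem along u, applied to the increment of f in the direction h v, and
    then along v, applied to the derivative of f along u, turns it into a
    single value of the mixed derivative. *)
Lemma mixed_difference f x u v (h : R) : 0 < h ->
  (forall y, differentiable f y) -> (forall y, differentiable ('D_u f) y) ->
  exists a b : R, [/\ 0 < a < h, 0 < b < h &
    f (h *: u + (h *: v + x)) - f (h *: u + x) - f (h *: v + x) + f x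
    = h * h * 'D_v ('D_u f) (b *: v + (a *: u + x))].
Proof.
move=> h0 df ddf.
pose g y := f (h *: v + y) - f y.
have ds y : differentiable (fun z => f (h *: v + z)) y.
  exact: (@differentiable_comp _ _ _ _ (fun z => h *: v + z) f).
have dg y : differentiable g y by exact: differentiableB.
have [a aI E1] := mean_value_line x u h0 dg.
have [b bI E2] := mean_value_line (a *: u + x) v h0 ddf.
exists a, b; split => //.
have Eg y : 'D_u g y = 'D_u f (h *: v + y) - 'D_u f y.
  by rewrite (deriveB (@diff_derivable _ _ _ _ _ u (ds y))
    (@diff_derivable _ _ _ _ _ u (df y))) derive_translate.
rewrite -mulrA -E2 -Eg -E1 /g [h *: u + _]addrCA opprB.
by rewrite addrA addrAC [RHS]addrA [in RHS]addrAC.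
Qed.

(** Schwarz's theorem. The second difference is symmetric in u and v, so by
    mixed_difference it equals h^2 times a value of either mixed derivative
    near x; by continuity both are arbitrarily close to their values at x. *)
Lemma derive_comm f u v x :
  (forall y, differentiable f y) -> (forall w y, differentiable ('D_w f) y) ->
  {for x, continuous ('D_v ('D_u f))} -> {for x, continuous ('D_u ('D_v f))} ->
  'D_v ('D_u f) x = 'D_u ('D_v f) x.
Proof.
move=> df ddf cvu cuv.
have line_cvg w w' (g : V -> R) : {for x, continuous g} -> forall e : R, 0 < e ->
    exists2 d : R, 0 < d & forall a b : R, 0 < a < d -> 0 < b < d ->
      `|g x - g (b *: w + (a *: w' + x))| < e.
  move=> cg e e0.
  have /nbhs_ballP[r /= r0 gr] : nbhs x [set y | `|g x - g y| < e].
    by move/cvgrPdist_lt : cg => /(_ e e0).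
  pose M := `|w| + `|w'| + 1.
  have M0 : 0 < M by rewrite /M ltr_wpDl // addr_ge0.
  exists (r / M); first exact: divr_gt0.
  move=> a b /andP[a0 aM] /andP[b0 bM]; apply: gr.
  rewrite -ball_normE /= distrC addrA addrK.
  apply: le_lt_trans (ler_normD _ _) _; rewrite !normrZ !gtr0_norm //.
  apply: (@le_lt_trans _ _ (r / M * `|w| + r / M * `|w'|)).
    by apply: lerD; apply: ler_wpM2r => //; exact: ltW.
  rewrite -mulrDr mulrAC ltr_pdivrMr // ltr_pM2l //.
  by rewrite /M ltrDl.
apply/eqP; rewrite -subr_eq0 -normr_le0; apply/ler_addgt0Pl => e e0.
rewrite addr0.
have e20 : 0 < e / 2 by rewrite divr_gt0.
have [d1 d10 D1] := line_cvg v u _ cvu _ e20.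
have [d2 d20 D2] := line_cvg u v _ cuv _ e20.
pose h := Num.min d1 d2.
have h0 : 0 < h by rewrite lt_min d10.
have [a [b [aI bI E1]]] := mixed_difference x v h0 df (ddf u).
have [a' [b' [aI' bI' E2]]] := mixed_difference x u h0 df (ddf v).
have small (r d : R) : h <= d -> 0 < r < h -> 0 < r < d.
  by move=> hd /andP[-> /= rh]; exact: lt_le_trans hd.
have E : 'D_v ('D_u f) (b *: v + (a *: u + x))
       = 'D_u ('D_v f) (b' *: u + (a' *: v + x)).
  apply: (mulfI (mulf_neq0 (lt0r_neq0 h0) (lt0r_neq0 h0))).
  apply: etrans (esym E1) _; apply: etrans E2.
  by rewrite [h *: u + (h *: v + x)]addrCA [X in X + _ = _]addrAC.
have h1 : h <= d1 by rewrite ge_min lexx.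
have h2 : h <= d2 by rewrite ge_min lexx orbT.
have L1 := D1 a b (small _ _ h1 aI) (small _ _ h1 bI).
have L2 := D2 a' b' (small _ _ h2 aI') (small _ _ h2 bI').
move: L1 L2; rewrite E.
move: ('D_v ('D_u f) x) ('D_u ('D_v f) x) ('D_u ('D_v f) (_ + _)) => A B m.
move=> L1 L2; apply: le_trans (ler_distD m _ _) _.
by rewrite (splitr e); apply: lerD; [|rewrite distrC]; exact: ltW.
Qed.

End MixedDerivatives.

(** * Smooth functions *)

Section SmoothEntries.
Context {R : realType} {V : normedModType R} {m n : nat}.

Lemma derive_entry (F : V -> 'M[R]_(m, n)) i j v x :
  derivable F x v -> 'D_v (fun y => F y i j) x = 'D_v F x i j.
Proof. by move=> dF; rewrite derive_mx // mxE. Qed.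

Lemma Cn_on_entry k (F : V -> 'M[R]_(m, n)) i j :
  Cn_on k setT F -> Cn_on k setT (fun y => F y i j).
Proof.
elim: k F => [|k IH] F /= => [cF x _|[dF cF]].
  apply: (@continuous_comp _ _ _ F (fun M : 'M[R]_(m, n) => M i j)); first exact: cF.
  exact: coord_continuous.
split=> [x _|v].
  apply: (@differentiable_comp _ _ _ _ F (fun M : 'M[R]_(m, n) => M i j)).
    exact: dF.
  exact: differentiable_coord.
rewrite (_ : 'D_v _ = fun y => 'D_v F y i j); first exact: IH.
by apply/funext => y; rewrite derive_entry //; exact/diff_derivable/dF.
Qed.

Lemma smooth_entry (F : V -> 'M[R]_(m, n)) i j :
  smooth F -> smooth (fun y => F y i j).
Proof. by move=> sF k; exact/Cn_on_entry/sF. Qed.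

End SmoothEntries.

Section SmoothConsequences.
Context {R : realType} {V : normedModType R}.

Lemma smooth_differentiable (W : normedModType R) (f : V -> W) x :
  smooth f -> differentiable f x.
Proof. by move=> /(_ 1%N)[df _]; exact: df. Qed.

Lemma smooth_derive (W : normedModType R) (f : V -> W) v :
  smooth f -> smooth ('D_v f).
Proof. by move=> sf k; have [_] := sf k.+1; apply. Qed.

Lemma smooth_derive_comm (f : V -> R) u v x :
  smooth f -> 'D_v ('D_u f) x = 'D_u ('D_v f) x.
Proof.
move=> sf.
have c w w' : {for x, continuous ('D_w ('D_w' f))}.
  by apply: differentiable_continuous; apply: smooth_differentiable;
    do 2!apply: smooth_derive.
by apply: derive_comm => // *; apply: smooth_differentiable => //;
  exact: smooth_derive.
Qed.

Lemma smooth_cst (W : normedModType R) (a : W) :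
  smooth (cst a : V -> W).
Proof.
move=> k; elim: k a => [|k IH] a /= => [x _|]; first exact: cst_continuous.
split=> // v; rewrite (_ : 'D_v _ = cst 0); first exact: IH.
by apply/funext => x; rewrite derive_cst.
Qed.

End SmoothConsequences.

Section Projections.
Context {R : realType} {V W : normedModType R}.

Lemma differentiable_fst (x : V * W) : differentiable (fst : V * W -> V) x.
Proof. by apply: linear_differentiable => y; exact: cvg_fst. Qed.

Lemma differentiable_snd (x : V * W) : differentiable (snd : V * W -> W) x.
Proof. by apply: linear_differentiable => y; exact: cvg_snd. Qed.

End Projections.

(** * Dot product and summation by parts *)

Section DotProduct.
Context {R : realType} {N : nat}.
Implicit Types u v w : 'rV[R]_N.

Lemma dotE u v : dot u v = (u *m v^T) ord0 ord0.
Proof. by rewrite /dot mxE; apply: eq_bigr => i _; rewrite mxE. Qed.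

Lemma dotC (u v : 'rV[R]_N) : dot u v = dot v u.
Proof. by apply: eq_bigr => i _; rewrite mulrC. Qed.

Lemma dotDl u v w : dot (u + v) w = dot u w + dot v w.
Proof. by rewrite !dotE mulmxDl mxE. Qed.

Lemma dotDr u v w : dot u (v + w) = dot u v + dot u w.
Proof. by rewrite !dotE linearD mulmxDr mxE. Qed.

Lemma dotZl a u v : dot (a *: u) v = a * dot u v.
Proof. by rewrite !dotE -scalemxAl mxE. Qed.

Lemma dotZr a u v : dot u (a *: v) = a * dot u v.
Proof. by rewrite !dotE linearZ -scalemxAr mxE. Qed.

Lemma dot_suml n (F : 'I_n -> 'rV[R]_N) v :
  dot (\sum_j F j) v = \sum_j dot (F j) v.
Proof. by rewrite dotE mulmx_suml summxE; apply: eq_bigr => j _; rewrite dotE. Qed.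

Lemma dot_sumr n (F : 'I_n -> 'rV[R]_N) u :
  dot u (\sum_j F j) = \sum_j dot u (F j).
Proof.
by rewrite dotE linear_sum mulmx_sumr summxE; apply: eq_bigr => j _; rewrite dotE.
Qed.

Lemma dot_mulmx_tr u v (A : 'M[R]_N) : dot (u *m A^T) v = dot u (v *m A).
Proof. by rewrite !dotE trmx_mul mulmxA. Qed.

End DotProduct.

Section RungeKuttaPairing.
Context {R : realType} {N s : nat}.
Variables (c : rsprk_coefs R s) (dt : R).
Hypothesis b_neq0 : forall i, cb c i != 0.
Hypothesis abarE : forall i j, ca_bar c i j = cb_bar c j * ca c i j / cb c j.
Hypothesis betaE : forall i j, cbeta c i j = cb c j * ca c j i / cb c i.
Hypothesis betabarE :
  forall i j, cbeta_bar c i j = cb_bar c j * ca c j i / cb c i.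

(** What stage i adds to q' - q when h, k are the derivatives in p, and to
    p - p' when they are the derivatives in q. *)
Definition stage_increment (h k : 'I_s -> 'rV[R]_N) (i : 'I_s) : 'rV[R]_N :=
  (dt * cb c i) *: h i + cb_bar c i *: k i.

(** The coefficient conditions say that the drift and the driving weights
    of each stage equation are b_j and bbar_j times one and the same factor,
    so that both parts of a stage enter only through its stage increment. *)
Lemma weighted_stage_sum (m mbar w : 'I_s -> R) (h k : 'I_s -> 'rV[R]_N) :
  (forall j, m j = cb c j * w j) -> (forall j, mbar j = cb_bar c j * w j) ->
  dt *: (\sum_j m j *: h j) + \sum_j mbar j *: k j
  = \sum_j w j *: stage_increment h k j.
Proof.
move=> mE mbarE; rewrite scaler_sumr -big_split; apply: eq_bigr => j _ /=.
rewrite mE mbarE /stage_increment scalerDr !scalerA.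
by rewrite mulrA !(mulrC (w j)).
Qed.

(** Summation by parts. With w_ij = a_ij / b_j, the stages are
    P_i = p' + sum_j w_ji l_j and dQ_i = dq + sum_j w_ij g_j, where l and g are
    the stage increments of the first and of the second system: the two weight matrices are transposes of each other,
    so the double sums in l and g cancel. The equations may come from two
    different systems: the conservation of p dq pairs the method with its
    linearisation, that of dp /\ dq pairs two solutions of the linearisation. *)
Lemma rk_equations_pairing hq hp kq kp (q p : 'rV[R]_N) Q P q' p'
    dhq dhp dkq dkp (dq dp : 'rV[R]_N) dQ dP dq' dp' :
  rk_equations c dt hq hp kq kp q p Q P q' p' ->
  rk_equations c dt dhq dhp dkq dkp dq dp dQ dP dq' dp' ->
  dot p dq = dot p' dq'
    + \sum_i (dot (stage_increment hq kq i) (dQ i)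
              - dot (P i) (stage_increment dhp dkp i)).
Proof.
move=> [_ PE _ pE] [dQE _ dq'E _].
set l := stage_increment hq kq; set g := stage_increment dhp dkp.
pose w i j := ca c i j / cb c j.
have {}PE i : P i = p' + \sum_j w j i *: l j.
  rewrite PE -addrA; congr (_ + _); apply: weighted_stage_sum => j.
    by rewrite betaE mulrA.
  by rewrite betabarE mulrA.
have {}dQE i : dQ i = dq + \sum_j w i j *: g j.
  rewrite dQE -addrA; congr (_ + _); apply: weighted_stage_sum => j.
    by rewrite mulrC divfK.
  by rewrite abarE mulrA.
have {}pE : p = p' + \sum_j l j.
  rewrite pE -addrA (@weighted_stage_sum _ _ (fun=> 1)) => [|j|j]; rewrite ?mulr1 //.
  by under eq_bigr do rewrite scale1r.
have {}dq'E : dq' = dq + \sum_j g j.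
  rewrite dq'E -addrA (@weighted_stage_sum _ _ (fun=> 1)) => [|j|j]; rewrite ?mulr1 //.
  by under eq_bigr do rewrite scale1r.
rewrite sumrB.
under [X in _ + (X - _)]eq_bigr do rewrite dQE dotDr dot_sumr.
under [X in _ + (_ - X)]eq_bigr do rewrite PE dotDl dot_suml.
rewrite !big_split /=.
have -> : \sum_i \sum_j dot (w j i *: l j) (g i)
        = \sum_i \sum_j dot (l i) (w i j *: g j).
  rewrite exchange_big /=; apply: eq_bigr => i _; apply: eq_bigr => j _.
  by rewrite dotZl dotZr.
rewrite pE dq'E dotDl dotDr dot_suml dot_sumr.
by ring.
Qed.

Variables (K : nat) (z : 'rV[R]_K).
Variables (H : phase R N -> R) (HH : phase R N -> 'rV[R]_K).

(** Since the increments are linear in the Hamiltonians, a conservation law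
    reduces to the pairing of a single Hamiltonian at a single stage. *)
Lemma stage_pairing (A B : 'I_s -> (phase R N -> R) -> 'rV[R]_N)
    (x y : 'I_s -> 'rV[R]_N) :
  \sum_i (dot (stage_increment (fun j => A j H)
                 (fun j => contract_incr (A j) HH z) i) (x i)
           - dot (y i) (stage_increment (fun j => B j H)
                 (fun j => contract_incr (B j) HH z) i))
  = dt * (\sum_i cb c i * (dot (A i H) (x i) - dot (y i) (B i H)))
  + \sum_i cb_bar c i * \sum_(l < K)
      (dot (A i (component HH l)) (x i) - dot (y i) (B i (component HH l)))
      * z ord0 l.
Proof.
rewrite mulr_sumr -big_split; apply: eq_bigr => i _ /=.
rewrite /stage_increment /contract_incr dotDl dotDr !dotZl !dotZr dot_suml dot_sumr.
rewrite opprD addrACA -!mulrBr -sumrB -mulrA; congr (_ + _ * _).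
rewrite -sumrB; apply: eq_bigr => l _.
by rewrite dotZl dotZr -mulrBr mulrC.
Qed.

End RungeKuttaPairing.

(** * Differentiating the method *)

Section PhaseCalculus.
Context {R : realType} {N : nat}.
Implicit Types (F : phase R N -> R) (x dx : phase R N).

Lemma phase_decomposition dx :
  dx = \sum_j dx.1 ord0 j *: e_q j + \sum_j dx.2 ord0 j *: e_p j.
Proof.
have sum0 (a : 'I_N -> R) : \sum_j a j *: (0 : 'rV[R]_N) = 0.
  by rewrite -scaler_suml scaler0.
have fstD (a b : phase R N) : (a + b).1 = a.1 + b.1 by [].
have sndD (a b : phase R N) : (a + b).2 = a.2 + b.2 by [].
apply: injective_projections; rewrite ?fstD ?sndD !raddf_sum /= sum0.
- by rewrite addr0; exact: row_sum_delta.
- by rewrite add0r; exact: row_sum_delta.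
Qed.

Lemma diff_phase F x dx : differentiable F x ->
  'd F x dx = dot dx.1 (pdq F x) + dot dx.2 (pdp F x).
Proof.
move=> dF; rewrite [in LHS](phase_decomposition dx) linearD !linear_sum.
by congr (_ + _); apply: eq_bigr => j _; rewrite linearZ mxE deriveE.
Qed.

Lemma dot_d2 (e e' : 'I_N -> phase R N) F x (a : 'rV[R]_N) j :
  dot a (\row_k 'D_(e' k) ('D_(e j) F) x) = (a *m (d2 e e' F x)^T) ord0 j.
Proof.
rewrite /dot [RHS]mxE; apply: eq_bigr => k _.
by rewrite [in LHS]mxE [in RHS]mxE [in RHS]mxE.
Qed.

Context {V : normedModType R}.

Lemma is_derive_mx m n (M : V -> 'M[R]_(m, n)) (dM : 'M[R]_(m, n)) t v :
  (forall i j, is_derive t v (fun y => M y i j) (dM i j)) -> is_derive t v M dM.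
Proof.
move=> dMij; have dMt : derivable M t v by apply/derivable_mxP => i j; exact: ex_derive.
split=> //; rewrite derive_mx //; apply/matrixP => i j; rewrite mxE.
exact: derive_val.
Qed.

Variables (Q P : V -> 'rV[R]_N) (t v : V).
Hypotheses (dQ : differentiable Q t) (dP : differentiable P t).
Let x : phase R N := (Q t, P t).

Lemma is_derive_phase_comp F : differentiable F x ->
  is_derive t v (fun y => F (Q y, P y))
    (dot ('D_v Q t) (pdq F x) + dot ('D_v P t) (pdp F x)).
Proof.
move=> dF; pose g y : phase R N := (Q y, P y).
have dg : differentiable g t by exact: differentiable_pair.
have dFg : differentiable (F \o g) t by exact: differentiable_comp.
split; first exact: diff_derivable.
rewrite (deriveE _ dFg) (diff_comp dg dF) /= (diff_phase _ dF).
by rewrite (diff_pair dQ dP) /= (deriveE _ dQ) (deriveE _ dP).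
Qed.

(** Differentiating the equations of the method along its solution produces
    the linearised right-hand sides: pdq and pdp are the cases e = e_q and
    e = e_p. *)
Lemma is_derive_d2 (e : 'I_N -> phase R N) F :
  (forall i, differentiable ('D_(e i) F) x) ->
  is_derive t v (fun y => \row_i 'D_(e i) F (Q y, P y))
    ('D_v P t *m (d2 e (@e_p R N) F x)^T + 'D_v Q t *m (d2 e (@e_q R N) F x)^T).
Proof.
move=> dF; apply: is_derive_mx => i j; rewrite ord1.
have -> : (fun y => (\row_i0 'D_(e i0) F (Q y, P y)) ord0 j)
        = (fun y => 'D_(e j) F (Q y, P y)) by apply/funext => y; rewrite mxE.
apply: is_derive_eq (is_derive_phase_comp (dF j)) _.
by rewrite [RHS]mxE [LHS]addrC (dot_d2 e (@e_p R N)) (dot_d2 e (@e_q R N)).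
Qed.

Lemma is_derive_pdq F :
  (forall w, differentiable ('D_w F) x) ->
  is_derive t v (fun y => pdq F (Q y, P y)) (lin_pdq F x ('D_v Q t, 'D_v P t)).
Proof. by move=> dF; exact: is_derive_d2. Qed.

Lemma is_derive_pdp F :
  (forall w, differentiable ('D_w F) x) ->
  is_derive t v (fun y => pdp F (Q y, P y)) (lin_pdp F x ('D_v Q t, 'D_v P t)).
Proof. by move=> dF; exact: is_derive_d2. Qed.

End PhaseCalculus.

Section Linearisation.
Context {R : realType} {V : normedModType R} {N s : nat}.

Lemma is_derive_lincomb n (k : 'I_n -> R) (h : 'I_n -> V -> 'rV[R]_N) dh (t v : V) :
  (forall j, is_derive t v (h j) (dh j)) ->
  is_derive t v (fun y => \sum_j k j *: h j y) (\sum_j k j *: dh j).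
Proof.
move=> dhj; have -> : (fun y => \sum_j k j *: h j y) = \sum_j k j \*: h j.
  by apply/funext => y; rewrite fct_sumE.
exact: is_derive_sum.
Qed.

Lemma rk_equations_derive (c : rsprk_coefs R s) dt
    (hq hp kq kp : 'I_s -> V -> 'rV[R]_N) dhq dhp dkq dkp
    (q p : V -> 'rV[R]_N) Q P q' p' (U : set V) (t v : V) :
  open U -> U t ->
  (forall y, U y -> rk_equations c dt (hq^~ y) (hp^~ y) (kq^~ y) (kp^~ y)
     (q y) (p y) (Q^~ y) (P^~ y) (q' y) (p' y)) ->
  (forall j, is_derive t v (hq j) (dhq j)) ->
  (forall j, is_derive t v (hp j) (dhp j)) ->
  (forall j, is_derive t v (kq j) (dkq j)) ->
  (forall j, is_derive t v (kp j) (dkp j)) ->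
  derivable q t v -> derivable p' t v ->
  rk_equations c dt dhq dhp dkq dkp
    ('D_v q t) ('D_v p t) (fun i => 'D_v (Q i) t) (fun i => 'D_v (P i) t)
    ('D_v q' t) ('D_v p' t).
Proof.
move=> oU Ut E Dhq Dhp Dkq Dkp /derivableP Dq /derivableP Dp'.
have nearU : \near t, U t by exact: open_nbhs_nbhs.
have combine (X x : V -> 'rV[R]_N) dx (a b : 'I_s -> R) h dh k dk :
    is_derive t v x dx ->
    (forall j, is_derive t v (h j) (dh j)) -> (forall j, is_derive t v (k j) (dk j)) ->
    (forall y, U y -> X y = x y + dt *: (\sum_j a j *: h j y) + \sum_j b j *: k j y) ->
    'D_v X t = dx + dt *: (\sum_j a j *: dh j) + \sum_j b j *: dk j.
  move=> Dx Dh Dk XE.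
  have D1 := is_derive_lincomb a Dh.
  have D2 := is_derive_lincomb b Dk.
  have D := is_deriveD (is_deriveD Dx (is_deriveZ dt D1)) D2.
  rewrite -(@derive_val _ _ _ _ _ _ _ D); apply: near_eq_derive.
  by apply: filterS nearU => y Uy; exact: XE.
by split=> [i|i||]; apply: combine => // y /E[].
Qed.

End Linearisation.

Section LinearisedMethod.
Context {R : realType} {N s : nat}.

Lemma derive_fst (x u : phase R N) : 'D_u fst x = u.1.
Proof.
by rewrite deriveE ?diff_lin //; [move=> y; exact: cvg_fst|exact: differentiable_fst].
Qed.

Lemma derive_snd (x u : phase R N) : 'D_u snd x = u.2.
Proof.
by rewrite deriveE ?diff_lin //; [move=> y; exact: cvg_snd|exact: differentiable_snd].
Qed.

(** The map defined by the method satisfies its equations identically on an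
    open set, so the derivatives of the map and of the stages solve the
    linearised equations. This turns statements on differential forms into
    statements on solutions of the linearisation. *)
Lemma rsprk_map_linearised K (c : rsprk_coefs R s) dt (z : 'rV[R]_K)
    (H : phase R N -> R) (HH : phase R N -> 'rV[R]_K) U
    (Q P : 'I_s -> phase R N -> 'rV[R]_N) (q' p' : phase R N -> 'rV[R]_N) x u :
  (forall w y, differentiable ('D_w H) y) ->
  (forall l w y, differentiable ('D_w (component HH l)) y) ->
  rsprk_map c dt z H HH U Q P q' p' -> U x ->
  rsprk_step_lin c dt z H HH (Q^~ x) (P^~ x) u.1 u.2
    (fun i => 'D_u (Q i) x) (fun i => 'D_u (P i) x) ('D_u q' x) ('D_u p' x).
Proof.
move=> dH dHH [oU [_ sp'] sQP E] Ux.
have dsm (f : phase R N -> 'rV[R]_N) : smooth_on U f -> differentiable f x.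
  by move=> /(_ 1%N)[+ _]; apply.
rewrite -{1}(derive_fst x u) -{1}(derive_snd x u).
apply: (rk_equations_derive
    (hq := fun j y => pdq H (Q j y, P j y)) (hp := fun j y => pdp H (Q j y, P j y))
    (kq := fun j y => contract_incr (fun F => pdq F (Q j y, P j y)) HH z)
    (kp := fun j y => contract_incr (fun F => pdp F (Q j y, P j y)) HH z)
    oU Ux E) => [j|j|j|j||].
- by apply: is_derive_pdq => //; apply: dsm; have [] := sQP j.
- by apply: is_derive_pdp => //; apply: dsm; have [] := sQP j.
- apply: is_derive_lincomb => l.
  by apply: is_derive_pdq => //; apply: dsm; have [] := sQP j.
- apply: is_derive_lincomb => l.
  by apply: is_derive_pdp => //; apply: dsm; have [] := sQP j.
- exact/diff_derivable/differentiable_fst.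
- exact/diff_derivable/dsm.
Qed.

End LinearisedMethod.

(** * Pairings of a single Hamiltonian *)

Section Hessian.
Context {R : realType} {N : nat}.
Implicit Types (F : phase R N -> R) (x : phase R N).

Lemma trmx_d2 e e' F x : smooth F -> (d2 e e' F x)^T = d2 e' e F x.
Proof.
move=> sF; apply/matrixP => i j; rewrite [LHS]mxE [LHS]mxE [RHS]mxE.
exact: smooth_derive_comm.
Qed.

(** The terms in the mixed block cancel on each side; what remains is the
    difference of two symmetric bilinear forms, in uq, vq and in up, vp. *)
Lemma symmetric_block_pairing (Mqq Mqp Mpq Mpp : 'M[R]_N) (uq up vq vp : 'rV[R]_N) :
  Mqq^T = Mqq -> Mpp^T = Mpp -> Mpq^T = Mqp ->
  dot (up *m Mqp^T + uq *m Mqq^T) vq - dot up (vp *m Mpp^T + vq *m Mpq^T)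
  = dot (vp *m Mqp^T + vq *m Mqq^T) uq - dot vp (up *m Mpp^T + uq *m Mpq^T).
Proof.
move=> sqq spp sqp; rewrite !dotDl !dotDr !dot_mulmx_tr sqp spp.
have -> : dot uq (vq *m Mqq) = dot vq (uq *m Mqq) by rewrite -dot_mulmx_tr sqq dotC.
have -> : dot up (vp *m Mpp) = dot vp (up *m Mpp) by rewrite -dot_mulmx_tr spp dotC.
by ring.
Qed.

Lemma hamiltonian_pairing_sym F x (uq up vq vp : 'rV[R]_N) : smooth F ->
  dot (lin_pdq F x (uq, up)) vq - dot up (lin_pdp F x (vq, vp))
  = dot (lin_pdq F x (vq, vp)) uq - dot vp (lin_pdp F x (uq, up)).
Proof. by move=> sF; apply: symmetric_block_pairing; exact: trmx_d2. Qed.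

End Hessian.

Section AffineHamiltonian.
Context {R : realType} {N : nat}.

(** The coefficients are scalar functions indexed by the coordinates of p, so
    that the drift, with coefficients f, and each component of the driving
    Hamiltonian, with coefficients a column of sigma, are both of this form. *)
Definition affine_hamiltonian (g : 'I_N -> 'rV[R]_N -> R) (L : 'rV[R]_N -> R)
  (x : phase R N) : R := \sum_i x.2 ord0 i * g i x.1 + L x.1.

Lemma differentiable_pullback_fst (W : normedModType R) (g : 'rV[R]_N -> W)
    (x : phase R N) :
  differentiable g x.1 -> differentiable (fun y : phase R N => g y.1) x.
Proof.
move=> dg; apply: (@differentiable_comp _ _ _ _ fst) => //.
exact: differentiable_fst.
Qed.

Lemma derive_pullback_fst (W : normedModType R) (g : 'rV[R]_N -> W)
    (x v : phase R N) :
  'D_v (fun y : phase R N => g y.1) x = 'D_(v.1) g x.1.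
Proof. by []. Qed.

Lemma differentiable_momentum i (x : phase R N) :
  differentiable (fun y : phase R N => y.2 ord0 i) x.
Proof.
apply: (@differentiable_comp _ _ _ _ snd (fun w : 'rV[R]_N => w ord0 i)).
  exact: differentiable_snd.
exact: differentiable_coord.
Qed.

Lemma derive_momentum i (x v : phase R N) :
  'D_v (fun y : phase R N => y.2 ord0 i) x = v.2 ord0 i.
Proof.
have dsnd : derivable (snd : phase R N -> 'rV[R]_N) x v.
  exact/diff_derivable/differentiable_snd.
by rewrite (derive_entry _ _ dsnd) derive_snd.
Qed.

Variables (g : 'I_N -> 'rV[R]_N -> R) (L : 'rV[R]_N -> R).
Hypotheses (sg : forall i, smooth (g i)) (sL : smooth L).

Lemma derive_affine_hamiltonian (x v : phase R N) :
  'D_v (affine_hamiltonian g L) x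
  = \sum_i (v.2 ord0 i * g i x.1 + x.2 ord0 i * 'D_(v.1) (g i) x.1)
    + 'D_(v.1) L x.1.
Proof.
pose t i : phase R N -> R :=
  (fun y : phase R N => y.2 ord0 i) * (fun y : phase R N => g i y.1).
have Dt i : is_derive x v (t i)
    (v.2 ord0 i * g i x.1 + x.2 ord0 i * 'D_(v.1) (g i) x.1).
  have Dp := derivableP (@diff_derivable _ _ _ _ _ v (differentiable_momentum i x)).
  have Dg := derivableP (@diff_derivable _ _ _ _ _ v
    (differentiable_pullback_fst (smooth_differentiable x.1 (sg i)))).
  apply: is_derive_eq (is_deriveM Dp Dg) _.
  by rewrite derive_momentum addrC; congr (_ + _); exact: mulrC.
have DL := derivableP (@diff_derivable _ _ _ _ _ v
  (differentiable_pullback_fst (smooth_differentiable x.1 sL))).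
have -> : affine_hamiltonian g L = \sum_i t i + (fun y : phase R N => L y.1).
  by apply/funext => y; rewrite /affine_hamiltonian /= fct_sumE.
exact: (@derive_val _ _ _ _ _ _ _ (is_deriveD (is_derive_sum Dt) DL)).
Qed.

Lemma differentiable_derive_affine_hamiltonian (v x : phase R N) :
  differentiable ('D_v (affine_hamiltonian g L)) x.
Proof.
have -> : 'D_v (affine_hamiltonian g L)
  = \sum_i ((fun y : phase R N => (v.2 ord0 i *: g i) y.1)
            + (fun y : phase R N => y.2 ord0 i)
              * (fun y : phase R N => 'D_(v.1) (g i) y.1))
    + (fun y : phase R N => 'D_(v.1) L y.1).
  by apply/funext => y; rewrite derive_affine_hamiltonian /= fct_sumE.
apply: differentiableD; last first.
  apply: (@differentiable_pullback_fst _ ('D_(v.1) L)).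
  exact/smooth_differentiable/smooth_derive.
apply: differentiable_sum => i; apply: differentiableD.
  apply: (@differentiable_pullback_fst _ (v.2 ord0 i *: g i)).
  exact/differentiableZ/smooth_differentiable.
apply: differentiableM; first exact: differentiable_momentum.
apply: (@differentiable_pullback_fst _ ('D_(v.1) (g i))).
exact/smooth_differentiable/smooth_derive.
Qed.

(** The momentum occurs linearly: the derivative in q of the sum of the
    p_i g_i(q), paired with dq, is p paired with the variation of g along dq,
    and the latter is the linearised derivative in p. Only the momentum-free
    part L contributes. *)
Lemma affine_hamiltonian_pairing (q p dq dp : 'rV[R]_N) :
  dot (pdq (affine_hamiltonian g L) (q, p)) dq
  - dot p (lin_pdp (affine_hamiltonian g L) (q, p) (dq, dp))
  = dot (grad L q) dq.
Proof.
have dpE i : 'D_(e_p i) (affine_hamiltonian g L) = fun x : phase R N => g i x.1.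
  apply/funext => y; rewrite derive_affine_hamiltonian /= !derive0 addr0.
  rewrite (bigD1 i) //= big1 ?addr0 => [|j /negPf ji].
    by rewrite derive0 mulr0 mxE !eqxx mul1r addr0.
  by rewrite derive0 mulr0 mxE ji andbF mul0r addr0.
have ppE : d2 e_p e_p (affine_hamiltonian g L) (q, p) = 0.
  apply/matrixP => i j; rewrite [LHS]mxE dpE derive_pullback_fst /= derive0.
  by rewrite mxE.
have pqE : d2 e_p e_q (affine_hamiltonian g L) (q, p)
    = \matrix_(i, j) 'D_(std_basis j) (g i) q.
  by apply/matrixP => i j; rewrite [LHS]mxE dpE derive_pullback_fst [RHS]mxE.
have qE : pdq (affine_hamiltonian g L) (q, p)
    = p *m (\matrix_(i, j) 'D_(std_basis j) (g i) q) + grad L q.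
  apply/rowP => j; rewrite [LHS]mxE derive_affine_hamiltonian [RHS]mxE.
  congr (_ + _); last by rewrite [RHS]mxE.
  rewrite [RHS]mxE; apply: eq_bigr => i _ /=.
  by rewrite [X in X * _]mxE mul0r add0r [X in _ = _ * X]mxE.
rewrite /lin_pdp ppE pqE qE /= trmx0 mulmx0 add0r dotDl.
by rewrite -[X in _ - X]dotC dot_mulmx_tr (dotC dq) addrAC subrr add0r.
Qed.

End AffineHamiltonian.

(** * Conservation laws *)

Section Forms.
Context {R : realType} {V : normedModType R} {N : nat}.
Implicit Types (p q : V -> 'rV[R]_N) (x u v : V).

Lemma ext_d_component q i x u :
  differentiable q x -> ext_d (component q i) x u = 'D_u q x ord0 i.
Proof.
move=> dq; have dqi : differentiable (component q i) x.
  apply: (@differentiable_comp _ _ _ _ q (fun w : 'rV[R]_N => w ord0 i)) => //.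
  exact: differentiable_coord.
rewrite /ext_d -(deriveE u dqi).
exact: (derive_entry ord0 i (@diff_derivable _ _ _ _ _ u dq)).
Qed.

Lemma p_dqE p q x u :
  differentiable q x -> p_dq p q x u = dot (p x) ('D_u q x).
Proof. by move=> dq; apply: eq_bigr => i _; rewrite ext_d_component. Qed.

Lemma dp_wedge_dqE p q x u v : differentiable p x -> differentiable q x ->
  dp_wedge_dq p q x u v
  = dot ('D_u p x) ('D_v q x) - dot ('D_v p x) ('D_u q x).
Proof.
move=> dp dq; rewrite /dot -sumrB; apply: eq_bigr => i _.
by rewrite /wedge !(ext_d_component _ _ dp) !(ext_d_component _ _ dq).
Qed.

End Forms.

Section ConservationLaws.
Context {R : realType} {N K s : nat}.
Variables (c : rsprk_coefs R s) (dt : R) (z : 'rV[R]_K).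
Hypothesis b_neq0 : forall i, cb c i != 0.
Hypothesis abarE : forall i j, ca_bar c i j = cb_bar c j * ca c i j / cb c j.
Hypothesis betaE : forall i j, cbeta c i j = cb c j * ca c j i / cb c i.
Hypothesis betabarE :
  forall i j, cbeta_bar c i j = cb_bar c j * ca c j i / cb c i.
Variables (H : phase R N -> R) (HH : phase R N -> 'rV[R]_K).

(** Pairing two solutions of the linearisation, every stage contributes a
    quantity that hamiltonian_pairing_sym shows to be symmetric in the two;
    antisymmetrising removes it. *)
Lemma linearised_steps_pairing (Q P : 'I_s -> 'rV[R]_N)
    (uq up : 'rV[R]_N) uQ uP uq' up' (vq vp : 'rV[R]_N) vQ vP vq' vp' :
  smooth H -> smooth HH ->
  rsprk_step_lin c dt z H HH Q P uq up uQ uP uq' up' ->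
  rsprk_step_lin c dt z H HH Q P vq vp vQ vP vq' vp' ->
  dot up vq - dot vp uq = dot up' vq' - dot vp' uq'.
Proof.
move=> sH sHH lin_u lin_v.
rewrite (rk_equations_pairing b_neq0 abarE betaE betabarE lin_u lin_v).
rewrite (rk_equations_pairing b_neq0 abarE betaE betabarE lin_v lin_u).
pose A (dQ dP : 'I_s -> 'rV[R]_N) j F := lin_pdq F (Q j, P j) (dQ j, dP j).
pose B (dQ dP : 'I_s -> 'rV[R]_N) j F := lin_pdp F (Q j, P j) (dQ j, dP j).
rewrite (stage_pairing c dt z H HH (A uQ uP) (B vQ vP)).
rewrite (stage_pairing c dt z H HH (A vQ vP) (B uQ uP)).
rewrite {}/A {}/B.
under eq_bigr do rewrite (hamiltonian_pairing_sym _ _ _ _ _ sH).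
under [X in _ + (_ + X) - _]eq_bigr => i _.
  under eq_bigr do
    rewrite (hamiltonian_pairing_sym _ _ _ _ _ (smooth_entry ord0 _ sHH)).
  over.
by rewrite opprD addrACA subrr addr0.
Qed.

(** Here the method itself is paired with its linearisation, and
    affine_hamiltonian_pairing evaluates every stage. *)
Lemma affine_step_pairing (g : 'I_N -> 'rV[R]_N -> R) (L : 'rV[R]_N -> R)
    (gg : 'I_K -> 'I_N -> 'rV[R]_N -> R) (LL : 'I_K -> 'rV[R]_N -> R)
    (q p : 'rV[R]_N) Q P q' p' (dq dp : 'rV[R]_N) dQ dP dq' dp' :
  (forall i, smooth (g i)) -> smooth L ->
  (forall l i, smooth (gg l i)) -> (forall l, smooth (LL l)) ->
  H = affine_hamiltonian g L ->
  (forall l, component HH l = affine_hamiltonian (gg l) (LL l)) ->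
  rsprk_step c dt z H HH q p Q P q' p' ->
  rsprk_step_lin c dt z H HH Q P dq dp dQ dP dq' dp' ->
  dot p dq = dot p' dq'
    + dt * \sum_i cb c i * dot (grad L (Q i)) (dQ i)
    + \sum_i cb_bar c i *
        \sum_(l < K) dot (grad (LL l) (Q i)) (dQ i) * z ord0 l.
Proof.
move=> sg sL sgg sLL HE HHE step lin.
rewrite (rk_equations_pairing b_neq0 abarE betaE betabarE step lin).
rewrite (stage_pairing c dt z H HH (fun j F => pdq F (Q j, P j))
  (fun j F => lin_pdp F (Q j, P j) (dQ j, dP j))).
rewrite addrA HE; congr (_ + dt * _ + _); apply: eq_bigr => i _; congr (_ * _).
  exact: affine_hamiltonian_pairing.
apply: eq_bigr => l _; congr (_ * _); rewrite HHE.
exact: affine_hamiltonian_pairing.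
Qed.

End ConservationLaws.

Theorem proposition3p5 (R : realType) (N K s : nat)
  (alpha t0 t1 : R) (alpha_gt : 1 / 3 < alpha) (alpha_le : alpha <= 1 / 2)
  (Z : R -> 'rV[R]_K) (ZZ : R -> R -> 'M[R]_K)
  (Zrough : geometric_rough_path alpha t0 t1 Z ZZ)
  (tk tk1 : R) (tk_ge : t0 <= tk) (tk_lt : tk < tk1) (tk1_le : tk1 <= t1)
  (c : rsprk_coefs R s)
  (b_neq0 : forall i, cb c i != 0) (bbar_neq0 : forall i, cb_bar c i != 0)
  (abarE : forall i j, ca_bar c i j = cb_bar c j * ca c i j / cb c j)
  (betaE : forall i j, cbeta c i j = cb c j * ca c j i / cb c i)
  (betabarE : forall i j, cbeta_bar c i j = cb_bar c j * ca c j i / cb c i) :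
  let dt := tk1 - tk in
  let z := Z tk1 - Z tk in
  [/\ (* all smooth Hamiltonians *)
      forall (H : phase R N -> R) (HH : phase R N -> 'rV[R]_K)
             (U : set (phase R N)) (Q P : 'I_s -> phase R N -> 'rV[R]_N)
             (q' p' : phase R N -> 'rV[R]_N),
        smooth H -> smooth HH ->
        rsprk_map c dt z H HH U Q P q' p' ->
        forall x, U x -> forall u v : phase R N,
          dp_wedge_dq snd fst x u v = dp_wedge_dq p' q' x u v,
      (* Hamiltonians linear in p *)
      forall (f : 'rV[R]_N -> 'rV[R]_N) (sigma : 'rV[R]_N -> 'M[R]_(N, K))
             (U : set (phase R N)) (Q P : 'I_s -> phase R N -> 'rV[R]_N)
             (q' p' : phase R N -> 'rV[R]_N),
        smooth f -> smooth sigma ->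
        rsprk_map c dt z (fun x => dot x.2 (f x.1)) (fun x => x.2 *m sigma x.1)
          U Q P q' p' ->
        forall x, U x -> forall u : phase R N,
          p_dq snd fst x u = p_dq p' q' x u
    & (* Hamiltonians affine in p *)
      forall (f : 'rV[R]_N -> 'rV[R]_N) (sigma : 'rV[R]_N -> 'M[R]_(N, K))
             (L : 'rV[R]_N -> R) (LL : 'rV[R]_N -> 'rV[R]_K)
             (q p : 'rV[R]_N) (Q P : 'I_s -> 'rV[R]_N) (q' p' : 'rV[R]_N)
             (dq dp : 'rV[R]_N) (dQ dP : 'I_s -> 'rV[R]_N) (dq' dp' : 'rV[R]_N),
        let H := fun x : phase R N => dot x.2 (f x.1) + L x.1 in
        let HH := fun x : phase R N => x.2 *m sigma x.1 + LL x.1 in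
        smooth f -> smooth sigma -> smooth L -> smooth LL ->
        rsprk_step c dt z H HH q p Q P q' p' ->
        rsprk_step_lin c dt z H HH Q P dq dp dQ dP dq' dp' ->
        dot p dq = dot p' dq'
          + dt * \sum_i cb c i * dot (grad L (Q i)) (dQ i)
          + \sum_i cb_bar c i *
              \sum_(l < K) dot (grad (component LL l) (Q i)) (dQ i) * z ord0 l].
Proof.
move=> dt z; split.
- move=> H HH U Q P q' p' sH sHH method x Ux u v.
  have dH w y : differentiable ('D_w H) y.
    exact/smooth_differentiable/smooth_derive.
  have dHH l w y : differentiable ('D_w (component HH l)) y.
    exact/smooth_differentiable/smooth_derive/smooth_entry.
  have lin w := rsprk_map_linearised w dH dHH method Ux.
  have [_ [sq' sp'] _ _] := method.
  have dq' : differentiable q' x by have [+ _] := sq' 1%N; apply.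
  have dp' : differentiable p' x by have [+ _] := sp' 1%N; apply.
  rewrite (dp_wedge_dqE _ _ dp' dq') dp_wedge_dqE;
    [|exact: differentiable_snd|exact: differentiable_fst].
  rewrite !derive_fst !derive_snd.
  exact: (linearised_steps_pairing b_neq0 abarE betaE betabarE sH sHH
    (lin u) (lin v)).
- move=> f sigma U Q P q' p' sf ssigma method x Ux u.
  (* An affine Hamiltonian with zero momentum-free part, paired with the
     linearisation obtained by differentiating the map. *)
  have HE : (fun y : phase R N => dot y.2 (f y.1))
      = affine_hamiltonian (fun i y => f y ord0 i) (cst 0).
    by apply/funext => y; rewrite /affine_hamiltonian addr0.
  have HHE l : component (fun y : phase R N => y.2 *m sigma y.1) l
      = affine_hamiltonian (fun i y => sigma y i l) (cst 0).
    by apply/funext => y; rewrite /component mxE /affine_hamiltonian addr0.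
  have sg i := smooth_entry ord0 i sf.
  have sgg l i := smooth_entry i l ssigma.
  have s0 : smooth (cst 0 : 'rV[R]_N -> R) by exact: smooth_cst.
  have dH w y : differentiable ('D_w (fun y : phase R N => dot y.2 (f y.1))) y.
    by rewrite HE; exact: differentiable_derive_affine_hamiltonian.
  have dHH l w y : differentiable
      ('D_w (component (fun y : phase R N => y.2 *m sigma y.1) l)) y.
    by rewrite HHE; exact: differentiable_derive_affine_hamiltonian.
  have lin := rsprk_map_linearised u dH dHH method Ux.
  have [_ [sq' _] _ step] := method.
  have dq' : differentiable q' x by have [+ _] := sq' 1%N; apply.
  rewrite (p_dqE _ _ dq') p_dqE; last exact: differentiable_fst.
  rewrite derive_fst.
  rewrite (affine_step_pairing b_neq0 abarE betaE betabarE sg s0 sgg (fun=> s0)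
    HE HHE (step x Ux) lin).
  have grad0 q : grad (cst 0 : 'rV[R]_N -> R) q = 0.
    by apply/rowP => i; rewrite !mxE derive_cst.
  have dot0 (w : 'rV[R]_N) : dot 0 w = 0 by rewrite dotE mul0mx mxE.
  rewrite [X in dt * X]big1 => [|i _]; last by rewrite grad0 dot0 mulr0.
  rewrite big1 => [|i _]; last first.
    by rewrite big1 ?mulr0 // => l _; rewrite grad0 dot0 mul0r.
  by rewrite mulr0 !addr0.
- move=> f sigma L LL q p Q P q' p' dq dp dQ dP dq' dp' H HH sf ssigma sL sLL.
  apply: (affine_step_pairing b_neq0 abarE betaE betabarE
    (fun i => smooth_entry ord0 i sf) sL (fun l i => smooth_entry i l ssigma)
    (fun l => smooth_entry ord0 l sLL)) => // l.
  by apply/funext => y; rewrite /component /HH mxE [X in X + _]mxE.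
Qed.
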